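(* Let $g\ge0$, $d\ge1$, $k\ge0$, $n\ge1$ be integers and let $\Delta_1,\dots,\Delta_n\vdash d$. Then, as formal power series in $u_1,\dots,u_n$, $$\Phi_g\{z|(u_1,\Delta_1),\dots,(u_n,\Delta_n)|p^{(1)},\dots,p^{(k)},p\}=\Big[\prod_{i=1}^n\exp\big(u_iW(\Delta_i,z)\big)\Big]\Phi_g\{z||p^{(1)},\dots,p^{(k)},p\},$$ where the operators $W(\Delta_i,z)$ act in the variables $p$. In particular, for $g=0$ and $k=0,1$ (writing $q=p^{(1)}$ when $k=1$), $$\Phi_0\{z|(u_1,\Delta_1),\dots,(u_n,\Delta_n)|p\}=\Big[\prod_{i=1}^n\exp\big(u_iW(\Delta_i,z)\big)\Big]\Big(z^{-2d}\frac{p_1^d}{d!}\Big),$$ $$\Phi_0\{z|(u_1,\Delta_1),\dots,(u_n,\Delta_n)|q,p\}=\Big[\prod_{i=1}^n\exp\big(u_iW(\Delta_i,z)\big)\Big]\Big(\sum_{\Delta\vdash d}z^{-2l(\Delta)}\frac{|C_\Delta|}{d!}q_\Delta p_\Delta\Big).$$ Moreover, for $d\ge2$ and $\Delta=(2,1,\dots,1)\vdash d$, $$\Phi_0\{z|(u,\Delta)|p\}=\exp\big(uW((2,1,\dots,1),z)\big)\Big(z^{-2d}\frac{p_1^d}{d!}\Big),$$ $$\Phi_0\{z|(u,\Delta)|q,p\}=\exp\big(uW((2,1,\dots,1),z)\big)\Big(\sum_{\Gamma\vdash d}z^{-2l(\Gamma)}\frac{|C_\Gamma|}{d!}q_\Gamma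 p_\Gamma\Big),$$ which are the generating functions of the classical almost simple Hurwitz numbers and almost simple double Hurwitz numbers respectively.
   Context: For a partition $\Delta=(\delta_1,\dots,\delta_n)\vdash d$: $l(\Delta)=n$; $m_r(\Delta)=\#\{i:\delta_i=r\}$; $\Delta!=\prod_{r\ge1}m_r(\Delta)!$; $p_\Delta=p_{\delta_1}\cdots p_{\delta_n}$ (similarly $q_\Delta$, $p^{(i)}_\Delta$ for other families of time-variables $q=(q_1,q_2,\dots)$, $p^{(i)}=(p^{(i)}_1,p^{(i)}_2,\dots)$); $\frac{\partial}{\partial p_\Delta}=\frac{1}{\Delta!}\frac{\partial}{\partial p_{\delta_1}}\cdots\frac{\partial}{\partial p_{\delta_n}}$. $|C_\Delta|$ is the number of permutations in $S_d$ of cycle type $\Delta$. For $\lambda\vdash d$, $\dim\lambda$ and $\chi_\lambda(\Delta)$ denote the dimension of the irreducible representation of $S_d$ indexed by $\lambda$ and its character value on permutations of cycle type $\Delta$, and $\phi_\lambda(\Delta)=\frac{1}{\dim\lambda}|C_\Delta|\chi_\lambda(\Delta)$. Generalized Hurwitz numbers: for $g\ge0$ and $\Delta_1,\dots,\Delta_k\vdash d$, $\mu_g^{h,d}(\Delta_1,\dots,\Delta_k)$ is the number of equivalence classes (weighted by inverse order of automorphism group) of degree $d$ ramified coverings of a connected compact Riemann surface of genus $g$, by possibly disconnected Riemann surfaces of genus $h$, with ramification types $\Delta_1,\dots,\Delta_k$ over $k$ fixed points. It is given by $$\mu_g^{h,d}(\Delta_1,\dots,\Delta_k)=\sum_{\lambda\vdash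 d}\Big(\frac{\dim\lambda}{d!}\Big)^{2-2g}\phi_\lambda(\Delta_1)\cdots\phi_\lambda(\Delta_k),$$ where $h$ is determined by the Hurwitz formula $(2-2g)d-(2-2h)=\sum_{i=1}^k(d-l(\Delta_i))$. Genus expanded cut-and-join operator of $\Delta\vdash d$ ($z$ an indeterminate): $$W(\Delta,z)=\sum_{\Gamma,\Gamma'\vdash d}\frac{d!}{|C_{\Gamma'}|}\,z^{\,d+l(\Gamma')-l(\Delta)-l(\Gamma)}\,\mu_0^{h_+,d}(\Gamma',\Delta,\Gamma)\,p_\Gamma\frac{\partial}{\partial p_{\Gamma'}},$$ with $h_+$ determined by $2d-(2-2h_+)=(d-l(\Gamma'))+(d-l(\Delta))+(d-l(\Gamma))$. Generating function, a formal power series in the indeterminates $u_1,\dots,u_n$: $$\Phi_g\{z|(u_1,\Delta_1),\dots,(u_n,\Delta_n)|p^{(1)},\dots,p^{(k)},p\}=\sum_{l_1,\dots,l_n\ge0}\ \sum_{\Gamma,\Gamma_1,\dots,\Gamma_k\vdash d}z^{2h-2}\,\mu_g^{h,d}(\underbrace{\Delta_1,\dots,\Delta_1}_{l_1},\dots,\underbrace{\Delta_n,\dots,\Delta_n}_{l_n},\Gamma_1,\dots,\Gamma_k,\Gamma)\Big[\prod_{j=1}^n\frac{u_j^{l_j}}{l_j!}\Big]\Big[\prod_{i=1}^kp^{(i)}_{\Gamma_i}\Big]p_\Gamma,$$ where $2h-2$ is determined in each term by $$(2-2g)d-(2-2h)=\sum_{j=1}^nl_j(d-l(\Delta_j))+\sum_{j=1}^k(d-l(\Gamma_j))+(d-l(\Gamma)).$$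 $\Phi_g\{z||p^{(1)},\dots,p^{(k)},p\}$ denotes the case $n=0$ (no $\Delta_j$'s and no $u_j$'s), still for the fixed degree $d$. *)

(* Defs.v *)
From HB Require Import structures.
From mathcomp Require Import all_boot all_order all_algebra.
From mathcomp Require Import all_fingroup all_solvable all_field all_character.
From mathcomp Require Export fraction.
From mathcomp.multinomials Require Export mpoly.

Set Implicit Arguments.
Unset Strict Implicit.
Unset Printing Implicit Defensive.

Import GRing.Theory.
Local Open Scope ring_scope.

Definition is_intpartn (d : nat) (s : seq nat) : bool :=
  [&& sorted geq s, 0%N \notin s & sumn s == d].

Record intpartn (d : nat) :=
  IntPartn { parts :> seq nat; intpartnP : is_intpartn d parts }.

HB.instance Definition _ d := [isSub for @parts d].
HB.instance Definition _ d := [Countable of intpartn d by <:].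

Section IntpartnFinite.
Variable d : nat.

Definition intpartn_code (D : intpartn d) : d.-bseq 'I_d.+1 :=
  insub_bseq d (map inord D).

Definition intpartn_decode (s : d.-bseq 'I_d.+1) : option (intpartn d) :=
  insub (map val s).

Lemma part_leq (s : seq nat) r : r \in s -> (r <= sumn s)%N.
Proof.
elim: s => //= a s IH; rewrite inE => /orP[/eqP->|/IH h].
  exact: leq_addr.
exact: leq_trans h (leq_addl _ _).
Qed.

Lemma size_part_leq (s : seq nat) : 0%N \notin s -> (size s <= sumn s)%N.
Proof.
elim: s => //= a s IH; rewrite inE negb_or eq_sym -lt0n => /andP[a0 /IH h].
by rewrite -add1n leq_add.
Qed.

Lemma intpartn_codeK : pcancel intpartn_code intpartn_decode.
Proof.
case=> s sP; have /and3P[_ s0 /eqP sd] := sP.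
have hs : (size (map (@inord d) s) <= d)%N.
  by rewrite size_map -[X in (_ <= X)%N]sd size_part_leq.
have E : bseqval (insub_bseq d (map (@inord d) s)) = map inord s.
  exact: insubdK.
rewrite /intpartn_decode /intpartn_code /= E.
have -> : map val (map (@inord d) s) = s.
  rewrite -map_comp -[RHS]map_id; apply/eq_in_map => r rs /=.
  by rewrite inordK // ltnS -sd part_leq.
by rewrite insubT.
Qed.

End IntpartnFinite.

HB.instance Definition _ d : isFinite (intpartn d) :=
  PCanIsFinite (@intpartn_codeK d).

Lemma simple_partP d : (1 < d)%N -> is_intpartn d (2 :: nseq d.-2 1%N).
Proof.
case: d => [|[|d]] //= _; apply/and3P; split.
- by elim: d => //= -[].
- by rewrite inE mem_nseq andbF.
- by rewrite /= sumn_nseq mul1n.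
Qed.

Definition simple_part d (hd : (1 < d)%N) : intpartn d :=
  IntPartn (simple_partP hd).

(** [Delta! = \prod_r m_r(Delta)!]; every part is at most [d]. *)
Definition part_fact d (D : intpartn d) : nat :=
  (\prod_(1 <= r < d.+1) (count_mem r D)`!)%N.

Definition cycle_type d (s : 'S_d) : seq nat :=
  sort geq [seq #|(C : {set 'I_d})| | C <- enum (porbits s)].

Definition cycle_class d (D : intpartn d) : {set 'S_d} :=
  [set s | cycle_type s == parts D].

(** The irreducible characters are indexed by [Iirr [set: 'S_d]].  Only sums
    over all irreducible representations of [S_d] occur below, so their
    labelling by the partitions of [d] plays no role. *)
Definition irr_dim d (i : Iirr [set: 'S_d]) : algC := 'chi_i 1%g.

(** [cycle_class D] is a nonempty conjugacy class, so [repr] picks an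
    arbitrary permutation of cycle type [D]. *)
Definition irr_val d (i : Iirr [set: 'S_d]) (D : intpartn d) : algC :=
  'chi_i (repr (cycle_class D)).

Definition phi d (i : Iirr [set: 'S_d]) (D : intpartn d) : algC :=
  (irr_dim i)^-1 * #|cycle_class D|%:R * irr_val i D.

(** [mu g Ds] is the Hurwitz number of degree [d] coverings of a genus [g]
    surface with ramification types [Ds] (coverings weighted by the inverse
    order of their automorphism group), given by the character formula.  The
    genus [h] of the covering surface is not an argument, being determined by
    the others: see [euler]. *)
Definition mu d (g : nat) (Ds : seq (intpartn d)) : algC :=
  \sum_(i : Iirr [set: 'S_d])
    (irr_dim i / (d`!)%:R) ^ (2%:Z - 2%:Z * g%:Z) * \prod_(D <- Ds) phi i D.

(** The value of [2h - 2] given by the Riemann-Hurwitz formula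
    [(2 - 2g) d - (2 - 2h) = \sum_D (d - l(D))]. *)
Definition euler d (g : nat) (Ds : seq (intpartn d)) : int :=
  \sum_(D <- Ds) (d%:Z - (size D)%:Z) - (2%:Z - 2%:Z * g%:Z) * d%:Z.

(** Scalars: rational functions in the indeterminate [z]; all scalars below
    are Laurent polynomials in [z]. *)
Notation Kz := {fraction {poly algC}}.
Definition zvar : Kz := tofrac 'X.
Definition scal (c : algC) : Kz := tofrac c%:P.

(** There are [k.+1] families of time variables: family [0] is [p], and
    family [i = 1, ..., k] is [p^(i)].  In degree [d] only the variables of
    index [1, ..., d] occur; the variables of index [0] are never used. *)
Notation timepoly k d := {mpoly Kz[k.+1 * d.+1]}.

Definition tvar (k d : nat) (f : 'I_k.+1) (r : nat) : 'I_(k.+1 * d.+1) :=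
  mxvec_index f (inord r : 'I_d.+1).

Definition pmon (k d : nat) (f : 'I_k.+1) (D : intpartn d) : timepoly k d :=
  \prod_(r <- parts D) 'X_(tvar d f r).

Definition dpart (k d : nat) (D : intpartn d) (F : timepoly k d) :
    timepoly k d :=
  ((part_fact D)%:R : Kz)^-1 *:
    foldr (fun r (G : timepoly k d) => mderiv (tvar d (ord0 : 'I_k.+1) r) G)
          F (parts D).

(** The genus expanded cut-and-join operator [W(D, z)]. *)
Definition cutjoin (k d : nat) (D : intpartn d) (F : timepoly k d) :
    timepoly k d :=
  \sum_(G : intpartn d) \sum_(G' : intpartn d)
    (scal ((d`!)%:R / #|cycle_class G'|%:R * mu 0 [:: G'; D; G])
     * zvar ^ (d%:Z + (size G')%:Z - (size D)%:Z - (size G)%:Z))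
    *: (pmon ord0 G * dpart G' F).

(** A power series is the family of its coefficients, indexed by exponents. *)
Definition fps (n : nat) (A : Type) : Type := 'X_{1..n} -> A.

Definition fps_const (n : nat) (A : nmodType) (a : A) : fps n A :=
  fun m => if m == 0%MM then a else 0.
Arguments fps_const n {A} a _.

(** [umul j W] is the operator [u_j W], with [W] acting on coefficients. *)
Definition umul (n : nat) (A : nmodType) (j : 'I_n) (W : A -> A)
    (F : fps n A) : fps n A :=
  fun m => if m j == 0%N then 0 else W (F (m - U_(j))%MM).

(** [exp T = \sum_l T^l / l!] for an operator [T] which raises the total degree
    in the [u]'s by at least one, as [umul j W] does: the terms with
    [l > mdeg m] do not contribute to the coefficient at [m]. *)
Definition op_exp (n : nat) (A : lmodType Kz) (T : fps n A -> fps n A)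
    (F : fps n A) : fps n A :=
  fun m => \sum_(l < (mdeg m).+1) ((l`!)%:R : Kz)^-1 *: iter l T F m.

Lemma iter_umul0 (n : nat) (A : lmodType Kz) (j : 'I_n) (W : {additive A -> A})
    (F : fps n A) (m : 'X_{1..n}) l :
  (mdeg m < l)%N -> iter l (umul j W) F m = 0.
Proof.
elim: l m => // l IH m ml /=; rewrite /umul; case: eqP => // /eqP mj.
rewrite IH ?raddf0 //.
have le1m : (U_(j) <= m)%MM by rewrite lep1mP.
by move: ml; rewrite -{1}(submK le1m) mdegD mdeg1 addn1 ltnS.
Qed.

(** The composition [exp (u_1 W(D_1)) \o ... \o exp (u_n W(D_n))]. *)
Definition exp_cutjoin (k d n : nat) (Delta : n.-tuple (intpartn d)) :
    fps n (timepoly k d) -> fps n (timepoly k d) :=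
  \big[(fun S T => S \o T)/id]_(j < n)
    op_exp (umul j (@cutjoin k d (tnth Delta j))).

(** [D_1, ..., D_1, ..., D_n, ..., D_n], each [D_j] repeated [m j] times. *)
Definition repeated (d n : nat) (Delta : n.-tuple (intpartn d))
    (m : 'X_{1..n}) : seq (intpartn d) :=
  flatten [seq nseq (m j) (tnth Delta j) | j <- enum 'I_n].

(** [Phi_g {z | (u_1, D_1), ..., (u_n, D_n) | p^(1), ..., p^(k), p}]; the
    variables [p^(i)] attached to the entry [i] of the tuple [Gs] are those of
    family [lift ord0 i = i + 1]. *)
Definition Phi (g d k n : nat) (Delta : n.-tuple (intpartn d)) :
    fps n (timepoly k d) :=
  fun m =>
    \sum_(G : intpartn d) \sum_(Gs : k.-tuple (intpartn d))
      let Ds := repeated Delta m ++ Gs ++ [:: G] in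
      (zvar ^ euler g Ds * scal (mu g Ds)
       * \prod_(j < n) (((m j)`!)%:R : Kz)^-1)
      *: ((\prod_(i < k) pmon (lift ord0 i) (tnth Gs i)) * pmon ord0 G).

(** [Phi_g {z || p^(1), ..., p^(k), p}]: the case [n = 0], where the only
    exponent is [0]. *)
Definition Phi_nou (g d k : nat) : timepoly k d :=
  Phi g k ([tuple] : 0.-tuple (intpartn d)) 0%MM.

(** Coverings of the sphere with [l] simple branch points and arbitrary
    ramification [G] (resp. [G], [G']) over one (resp. two) further points. *)
Definition hurwitz_single d (hd : (1 < d)%N) (l : nat) (G : intpartn d) : algC :=
  mu 0 (nseq l (simple_part hd) ++ [:: G]).

Definition hurwitz_double d (hd : (1 < d)%N) (l : nat) (G G' : intpartn d) :
    algC :=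
  mu 0 (nseq l (simple_part hd) ++ [:: G; G']).

(** Their generating functions; a simple branch point contributes [1] to the
    Riemann-Hurwitz formula, so that [2h - 2] is [l - d - l(G)] (resp.
    [l - l(G) - l(G')]). *)
Definition hurwitz_single_gen d (hd : (1 < d)%N) : fps 1 (timepoly 0 d) :=
  fun m => let l := m ord0 in
    \sum_(G : intpartn d)
      (zvar ^ (l%:Z - d%:Z - (size G)%:Z) * scal (hurwitz_single hd l G)
       / (l`!)%:R) *: pmon ord0 G.

Definition hurwitz_double_gen d (hd : (1 < d)%N) : fps 1 (timepoly 1 d) :=
  fun m => let l := m ord0 in
    \sum_(G : intpartn d) \sum_(G' : intpartn d)
      (zvar ^ (l%:Z - (size G)%:Z - (size G')%:Z)
       * scal (hurwitz_double hd l G G') / (l`!)%:R)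
      *: (pmon (lift ord0 ord0) G * pmon ord0 G').

(** [z^(-2d) p_1^d / d!] *)
Definition init_single (d : nat) : timepoly 0 d :=
  (zvar ^ (- (2%:Z * d%:Z)) / (d`!)%:R) *: 'X_(tvar d (ord0 : 'I_1) 1) ^+ d.

(** [\sum_D z^(-2 l(D)) |C_D| / d! q_D p_D], with [q = p^(1)] *)
Definition init_double (d : nat) : timepoly 1 d :=
  \sum_(D : intpartn d)
    (zvar ^ (- (2%:Z * (size D)%:Z)) * (#|cycle_class D|%:R / (d`!)%:R))
    *: (pmon (lift ord0 ord0) D * pmon ord0 D).

(* Main.v *)
From HB Require Import structures.
Require Import Defs.
From mathcomp Require Import all_boot all_order all_algebra.
From mathcomp Require Import all_fingroup all_solvable all_field all_character.
From mathcomp Require Import ring.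

(** By Riemann-Hurwitz and the orthogonality of characters, gluing a covering
    of genus [g] to a covering of the sphere along a common ramification type
    [G'], and summing over [G'] with weight [d! / |C_G'|], composes Hurwitz
    numbers: this uses that the characters of [S_d] are real and constant on
    each cycle type.  Since [d/dp_G' p_G] is [1] or [0] according as [G' = G] or
    not, this says that [W(D, z)] applied to the generating function with
    ramification list [L] yields the one with list [D :: L].  As [u_j W(D_j)]
    raises the exponent of [u_j], only the term of order [m_j] of each
    exponential contributes to the coefficient of [u^m].  The initial conditions
    are the two orthogonality relations again. *)

Set Implicit Arguments.
Unset Strict Implicit.
Unset Printing Implicit Defensive.

Import GRing.Theory Num.Theory.

(** * Matching two lists along equal multisets of labels *)

Lemma perm_map_lift (A B C : eqType) (f : A -> C) (g : B -> C)
    (u : seq A) (v : seq B) :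
  perm_eq (map f u) (map g v) -> exists2 w, perm_eq w v & map f u = map g w.
Proof.
elim: u v => [|a u IH] v /= e.
  by exists [::] => //; move: (perm_size e); rewrite /= size_map; case: (v).
have /mapP[b bv fa] : f a \in map g v by rewrite -(perm_mem e) mem_head.
have ev := perm_to_rem bv.
have /IH[w ew fw] : perm_eq (map f u) (map g (rem b v)).
  move: e; rewrite fa (perm_sym (_ :: _)) (permPl (perm_map g ev)) /=.
  by rewrite perm_cons perm_sym.
exists (b :: w); last by rewrite /= fw fa.
by rewrite (perm_sym _ v) (permPl ev) perm_cons perm_sym.
Qed.

(** Applied to the orbits of two permutations, labelled by their sizes: equal cycle types yield a
    size-preserving injection of orbits. The element [b0] only serves as default for [nth]. *)
Lemma exists_matching (A B C : eqType) (f : A -> C) (g : B -> C)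
    (u : seq A) (v : seq B) : B -> uniq v -> perm_eq (map f u) (map g v) ->
  exists2 h : A -> B, {in u &, injective h} &
    {in u, forall x, h x \in v /\ g (h x) = f x}.
Proof.
move=> b0 uv /perm_map_lift[w ewv e]; have sz : size u = size w.
  by rewrite -(size_map f) e size_map.
exists (fun x => nth b0 w (index x u)).
  move=> x y xu yu /eqP; rewrite nth_uniq -?sz ?index_mem ?(perm_uniq ewv) //.
  by move=> /eqP /(congr1 (nth x u)); rewrite !nth_index.
move=> x xu; rewrite -(perm_mem ewv) mem_nth -?sz ?index_mem //; split=> //.
by rewrite -(nth_map _ (f x)) -?sz ?index_mem // -e (nth_map x) ?index_mem // nth_index.
Qed.

(** * Permutations with the same orbit sizes are conjugate *)

Section PermConj.
Variable T : finType.
Implicit Types (s t p : {perm T}) (x : T).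

(** Exponents reduce modulo the size of the orbit, and the first [n] iterates list the orbit without
    repetition. *)
Lemma eq_iter_porbit s x i j :
  (iter i s x == iter j s x) = (i == j %[mod #|porbit s x|]).
Proof.
set n := #|_|; have n0 : 0 < n by rewrite lt0n card_porbit_neq0.
have P k : iter k s x = nth x (traject s x n) (k %% n).
  rewrite nth_traject ?ltn_pmod // {1}(divn_eq k n) addnC iterD; congr iter.
  by elim: (k %/ n) => // m IH; rewrite mulSn iterD IH iter_porbit.
by rewrite !P nth_uniq ?size_traject ?ltn_pmod ?uniq_traject_porbit.
Qed.

Lemma porbit_iter s i x : porbit s (iter i s x) = porbit s x.
Proof. by rewrite -permX porbit_perm. Qed.

Lemma cycle_card_conj s t :
  perm_eq [seq #|(C : {set T})| | C <- enum (porbits s)]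
          [seq #|(C : {set T})| | C <- enum (porbits t)] ->
  exists p, t = (s ^ p)%g.
Proof.
move=> /(exists_matching set0 (enum_uniq _))[F Finj FP].
have sO x : porbit s x \in enum (porbits s) by rewrite mem_enum imset_f.
have{FP} FP x : F (porbit s x) \in porbits t /\ #|F (porbit s x)| = #|porbit s x|.
  by have [] := FP _ (sO x); rewrite mem_enum.
(* [f] sends [s^i (A x)] to [t^i (B x)], where [A x] and [B x] are base points of
   the orbit of [x] and of the orbit of [t] matched with it. *)
pose a (C : {set T}) x0 := odflt x0 [pick x in C].
(* The point picked in a nonempty set does not depend on the default, so [A] and [B] below are
   constant on the orbits of [s]. *)
have aP (C : {set T}) x y : x \in C -> a C x \in C /\ a C y = a C x.
  by rewrite /a; case: pickP => // h xC; rewrite h in xC.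
pose A x := a (porbit s x) x; pose B x := a (F (porbit s x)) x.
have AP x : porbit s (A x) = porbit s x.
  by apply/eqP; rewrite eq_porbit_mem; case: (aP _ x x (porbit_id s x)).
have BP x : porbit t (B x) = F (porbit s x).
  have [/imsetP[z _ e] _] := FP x.
  rewrite /B e; apply/eqP; rewrite eq_porbit_mem.
  by have [h1 h2] := aP _ z x (porbit_id t z); rewrite h2.
have Aeq x y : porbit s x = porbit s y -> A x = A y.
  rewrite /A => e; rewrite -e.
  by have [_ ->] := aP _ x y (porbit_id s x).
have Beq x y : porbit s x = porbit s y -> B x = B y.
  rewrite /B => e; rewrite -e; have [/imsetP[z _ ->] _] := FP x.
  have [_ ->] := aP _ z x (porbit_id t z).
  by have [_ ->] := aP _ z y (porbit_id t z).
have xA x : exists i, x == iter i s (A x).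
  have : x \in porbit s (A x) by rewrite AP porbit_id.
  by case/porbitP=> i e; exists i; rewrite -permX -e.
pose f x := iter (xchoose (xA x)) t (B x).
(* Two exponents leading from [A x] to [x] agree modulo the size of the orbit, which is also the
   size of the matched orbit of [t]; so [f] does not depend on the exponent chosen. *)
have fE x i : x = iter i s (A x) -> f x = iter i t (B x).
  move=> e; apply/eqP; rewrite /f eq_iter_porbit BP.
  rewrite (FP x).2 -AP -eq_iter_porbit -e eq_sym.
  exact: (xchooseP (xA x)).
have fS x : f (s x) = t (f x).
  have [i /eqP e] := xA x; have es : porbit s (s x) = porbit s x := porbit_iter s 1 x.
  rewrite (fE x i e) (fE (s x) i.+1) ?(Beq _ _ es) //.
  by rewrite (Aeq _ _ es) /= -e.
have finj : injective f.
  move=> x y; have [i /eqP ex] := xA x; have [j /eqP ey] := xA y.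
  rewrite (fE x i ex) (fE y j ey) => e.
  (* Equal images lie in one orbit of [t], and the matching of orbits is injective; within one orbit
     the exponents are then compared modulo its size. *)
  have es : porbit s x = porbit s y.
    apply: Finj => //; rewrite -!BP.
    by rewrite -(porbit_iter t i) e porbit_iter.
  rewrite ex ey (Aeq _ _ es); apply/eqP; rewrite eq_iter_porbit AP.
  rewrite -(FP y).2 -BP -eq_iter_porbit -e.
  by rewrite (Beq _ _ es).
exists (perm finj); apply/permP => x.
have -> : x = perm finj ((perm finj)^-1%g x) by rewrite permKV.
by rewrite permJ !permE fS.
Qed.

Lemma porbitJ s p x : porbit (s ^ p)%g (p x) = p @: porbit s x.
Proof.
apply/setP => y; apply/porbitP/imsetP => [[i ->]|[z /porbitP[i ->] ->]].
  by exists ((s ^+ i)%g x); rewrite ?mem_porbit // -conjXg permJ.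
by exists i; rewrite -conjXg permJ.
Qed.

Lemma porbitsJ s p :
  porbits (s ^ p)%g = (fun C : {set T} => p @: C) @: porbits s.
Proof.
apply/setP => C; apply/imsetP/imsetP => [[x _ ->]|[_ /imsetP[x _ ->] ->]].
  exists (porbit s (p^-1%g x)); first exact: imset_f.
  by rewrite -porbitJ permKV.
by exists (p x); rewrite ?porbitJ.
Qed.

End PermConj.

(** * Cycle types as conjugacy invariants and as partitions *)

Section CycleType.
Variable d : nat.
Implicit Types (s t : 'S_d) (D : intpartn d).

Lemma cycle_type_eqP s t :
  reflect (exists p, t = (s ^ p)%g) (cycle_type s == cycle_type t).
Proof.
rewrite /cycle_type; apply: (iffP eqP) => [/perm_sortP h|[p ->]].
  apply: cycle_card_conj; apply: h.
  - by move=> m n; exact: leq_total.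
  - by move=> m n q h1 h2; exact: leq_trans h2 h1.
  - by move=> m n /anti_leq.
apply/perm_sortP.
- by move=> m n; exact: leq_total.
- by move=> m n q h1 h2; exact: leq_trans h2 h1.
- by move=> m n /anti_leq.
have pinj : injective (fun C : {set 'I_d} => p @: C).
  by apply: imset_inj; exact: perm_inj.
have e : perm_eq (enum (porbits (s ^ p)%g))
    [seq p @: (C : {set 'I_d}) | C <- enum (porbits s)].
  apply: uniq_perm; rewrite ?map_inj_uniq ?enum_uniq // => C.
  rewrite mem_enum porbitsJ; apply/imsetP/mapP => [[C' h ->]|[C' h ->]].
    by exists C'; rewrite ?mem_enum.
  by exists C'; rewrite // mem_enum in h *.
rewrite perm_sym (permPl (perm_map _ e)) -map_comp.
rewrite (eq_map (g := fun C : {set 'I_d} => #|C|)) // => C /=.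
by rewrite card_imset //; exact: perm_inj.
Qed.

Lemma cycle_typeV s : cycle_type s^-1%g = cycle_type s.
Proof. by rewrite /cycle_type porbitsV. Qed.

Lemma cycle_typeP s : is_intpartn d (cycle_type s).
Proof.
apply/and3P; split.
- by apply: sort_sorted => m n; exact: leq_total.
- rewrite mem_sort; apply/negP => /mapP[C]; rewrite mem_enum => /imsetP[x _ ->].
  by move/eqP; rewrite eq_sym (negPf (card_porbit_neq0 _ _)).
rewrite (perm_sumn (permEl (perm_sort _ _))) sumnE big_map big_enum /=.
rewrite -[X in _ == X]card_ord -sum1_card.
(* Each point is counted in its own orbit, so the orbit sizes add up to [d]. *)
rewrite (partition_big (porbit s) (mem (porbits s))) /=; last first.
  by move=> x _; exact: imset_f.
apply/eqP; apply: eq_bigr => _ /imsetP[x _ ->].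
by rewrite -sum1_card; apply: eq_bigl => y; rewrite eq_porbit_mem.
Qed.

End CycleType.

Local Open Scope ring_scope.

(** * Orthogonality of characters and gluing of Hurwitz numbers *)

Section Characters.
Variable d : nat.
Implicit Types (s t : 'S_d) (D : intpartn d) (i j : Iirr [set: 'S_d]).

Definition perm_part s : intpartn d := IntPartn (cycle_typeP s).

Lemma mem_cycle_class s D : (s \in cycle_class D) = (perm_part s == D).
Proof. by rewrite inE. Qed.

Lemma cycle_classE s D : s \in cycle_class D -> cycle_class D = (s ^: [set: 'S_d])%g.
Proof.
rewrite mem_cycle_class => /eqP <-; apply/setP => t; rewrite inE eq_sym /=.
apply/cycle_type_eqP/imsetP => [[p ->]|[p _ ->]]; last by exists p.
by exists p; rewrite ?inE.
Qed.

Lemma irr_val_class i s D : s \in cycle_class D -> irr_val i D = 'chi_i s.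
Proof.
move=> sD; rewrite /irr_val.
have : repr (cycle_class D) \in cycle_class D by exact: mem_repr sD.
by rewrite (cycle_classE sD) => /imsetP[p pG {1}->]; rewrite cfunJ.
Qed.

(** A permutation and its inverse have the same orbits, hence are conjugate: the characters of the
    symmetric group are real. *)
Lemma irr_permV i s : 'chi_i s^-1%g = 'chi_i s.
Proof.
have sV : s \in cycle_class (perm_part s^-1%g) by rewrite inE /= cycle_typeV.
by rewrite -(irr_val_class i sV) -(irr_val_class i (D := perm_part s^-1%g)) // inE.
Qed.

(** The first orthogonality relation with the sum over the group cut into the fibres of [perm_part];
    reality of the characters removes the inverse. *)
Lemma irr_val_orthogonal1 i j :
  \sum_D #|cycle_class D|%:R * (irr_val i D * irr_val j D) =
    (i == j)%:R * (d`!)%:R :> algC.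
Proof.
have := first_orthogonality_relation i j.
rewrite cardsT card_Sn => <-.
rewrite mulrC mulrA mulfV ?mul1r ?pnatr_eq0 -?lt0n ?fact_gt0 //.
rewrite (partition_big perm_part predT) //=; apply: eq_bigr => D _.
rewrite mulr_natl -sumr_const; apply: eq_big => s.
  by rewrite mem_cycle_class in_setT.
by move=> sD; rewrite irr_permV !(irr_val_class _ sD).
Qed.

(** Both class sizes are kept as factors so that the relation holds without knowing that every
    partition is a cycle type: an empty class makes both sides vanish. *)
Lemma irr_val_orthogonal2 D D' :
  #|cycle_class D|%:R * #|cycle_class D'|%:R * \sum_i irr_val i D * irr_val i D' =
    (#|cycle_class D| * d`!)%:R *+ (D == D') :> algC.
Proof.
have [->|[s sD]] := set_0Vmem (cycle_class D).
  by rewrite cards0 !mul0r mul0n mul0rn.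
have [D'0|[t tD']] := set_0Vmem (cycle_class D').
  case: eqP => [e|_]; last by rewrite D'0 cards0 mulr0 mul0r.
  by rewrite e D'0 inE in sD.
under eq_bigr => i _ do
  rewrite (irr_val_class i sD) (irr_val_class i tD') -[X in _ * X]irr_permV irr_inv.
rewrite second_orthogonality_relation ?inE //.
have -> : (s \in (t ^: [set: 'S_d])%g) = (D == D').
  rewrite -(cycle_classE tD') mem_cycle_class; congr (_ == _).
  by apply/eqP; rewrite -mem_cycle_class.
case: eqP => [<-|_]; last by rewrite !mulr0n mulr0.
(* The second orthogonality relation produced the order of the centralizer of [t]; multiplied by the
   size of the class it gives the order of the group. *)
rewrite !mulr1n -!natrM -mulnA; congr ((_ * _)%:R); rewrite (cycle_classE sD).
by rewrite -index_cent1 mulnC (Lagrange (subcent1_sub _ _)) cardsT card_Sn.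
Qed.

Lemma irr_dim_neq0 i : irr_dim i != 0. Proof. exact: irr1_neq0. Qed.

Lemma fact_natr_neq0 : (d`!)%:R != 0 :> algC.
Proof. by rewrite pnatr_eq0 -lt0n fact_gt0. Qed.

Lemma mu0E Ds : mu 0 Ds =
  \sum_(i : Iirr [set: 'S_d]) (irr_dim i / (d`!)%:R) ^+ 2 * \prod_(D <- Ds) phi i D.
Proof. by rewrite /mu mulr0 subr0. Qed.

Lemma phi_orthogonal i j :
  \sum_D (d`!)%:R / #|cycle_class D|%:R * (phi i D * phi j D) =
    (i == j)%:R * ((d`!)%:R / irr_dim i) ^+ 2.
Proof.
transitivity ((d`!)%:R / (irr_dim i * irr_dim j) *
    \sum_D #|cycle_class D|%:R * (irr_val i D * irr_val j D)).
  rewrite mulr_sumr; apply: eq_bigr => D _; rewrite /phi.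
  have [->|D0] := eqVneq (#|cycle_class D|%:R : algC) 0; first by rewrite !(mulr0, mul0r).
  by field; rewrite D0 !irr_dim_neq0.
rewrite irr_val_orthogonal1; case: eqP => [->|_]; last by rewrite !mul0r mulr0.
by field; rewrite irr_dim_neq0.
Qed.

(** After both character sums are expanded, [phi_orthogonal] kills the terms with distinct
    characters, and its factor [(d! / dim)^2] cancels the [(dim / d!)^2] of the sphere. *)
Lemma mu_glue g D G (Ds : seq (intpartn d)) :
  \sum_G' (d`!)%:R / #|cycle_class G'|%:R * mu 0 [:: G'; D; G] * mu g (rcons Ds G') =
    mu g (D :: rcons Ds G).
Proof.
pose e : int := 2%:Z - 2%:Z * g%:Z.
(* The index [i] belongs to the sphere and [j] to the surface of genus [g]; only the last sum
   involves the glued type [G']. *)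
transitivity (\sum_(i : Iirr [set: 'S_d]) \sum_(j : Iirr [set: 'S_d])
   (irr_dim i / (d`!)%:R) ^+ 2 * (phi i D * phi i G)
   * ((irr_dim j / (d`!)%:R) ^ e * \prod_(D <- Ds) phi j D)
   * \sum_G' (d`!)%:R / #|cycle_class G'|%:R * (phi i G' * phi j G')).
  under [RHS]eq_bigr => i _ do
    (under eq_bigr => j _ do rewrite mulr_sumr; rewrite exchange_big /=).
  rewrite [RHS]exchange_big /=; apply: eq_bigr => G' _.
  rewrite mu0E -mulrA mulr_suml mulr_sumr; apply: eq_bigr => i _.
  rewrite /mu !mulr_sumr; apply: eq_bigr => j _.
  rewrite !big_cons big_nil mulr1 big_rcons /= -/e.
  set x := (_ ^+ 2); set y := (_ ^ e); set z := (_ / _); ring.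
apply: eq_bigr => i _; rewrite (bigD1 i) //= [X in _ + X]big1 => [|j ji]; last first.
  by rewrite phi_orthogonal eq_sym (negPf ji) mul0r mulr0.
rewrite phi_orthogonal eqxx addr0 mul1r big_cons big_rcons /= -/e.
set y := (_ ^ e); field; by rewrite fact_natr_neq0 irr_dim_neq0.
Qed.

(** For exactly two ramification points on the sphere the dimensions cancel, which leaves the sum of
    the second orthogonality relation. *)
Lemma phi_mul i D D' : (irr_dim i / (d`!)%:R) ^+ 2 * (phi i D * phi i D') =
  #|cycle_class D|%:R * #|cycle_class D'|%:R / (d`!)%:R ^+ 2 * (irr_val i D * irr_val i D').
Proof. by rewrite /phi; field; rewrite fact_natr_neq0 irr_dim_neq0. Qed.

Lemma mu0_pair D D' :
  mu 0 [:: D; D'] = (#|cycle_class D|%:R / (d`!)%:R) *+ (D == D').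
Proof.
rewrite mu0E; under eq_bigr => i _ do rewrite !big_cons big_nil mulr1 phi_mul.
rewrite -mulr_sumr mulrAC irr_val_orthogonal2 natrM.
case: eqP => _; last by rewrite !mulr0n mul0r.
by rewrite !mulr1n; field; rewrite fact_natr_neq0.
Qed.

(** The partition into ones, obtained as the cycle type of the identity so that its class is
    computed at once. *)
Definition one_part : intpartn d := perm_part 1.

Lemma cycle_class1 : cycle_class one_part = [set 1%g].
Proof.
have h : 1%g \in cycle_class one_part by rewrite mem_cycle_class.
by rewrite (cycle_classE h) class1G.
Qed.

Lemma parts_one_part : parts one_part = nseq d 1%N.
Proof.
have /and3P[_ _ /eqP sd] := intpartnP one_part.
have e : all (pred1 1%N) one_part.
  rewrite /= /cycle_type all_sort; apply/allP => m /mapP[C].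
  rewrite mem_enum => /imsetP[x _ ->] ->.
  by rewrite porbit.unlock cycle1 imset_set1 cards1.
have {}e := all_pred1P _ _ e.
by rewrite e; congr nseq; rewrite -[RHS]sd [in RHS]e sumn_nseq mul1n.
Qed.

Lemma phi_one_part i : phi i one_part = 1.
Proof.
rewrite /phi cycle_class1 cards1 mulr1 (irr_val_class i (s := 1%g)) ?mem_cycle_class //.
by rewrite mulVf ?irr_dim_neq0.
Qed.

(** An unramified point contributes the factor 1, so it can be added to reach the case of two
    points. *)
Lemma mu0_single D : mu 0 [:: D] = (d`!)%:R^-1 *+ (D == one_part).
Proof.
transitivity (mu 0 [:: one_part; D]).
  by rewrite !mu0E; apply: eq_bigr => i _; rewrite !big_cons phi_one_part mul1r.
by rewrite mu0_pair cycle_class1 cards1 mul1r eq_sym.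
Qed.

End Characters.

(** * Constants inside the rational functions of [z] *)

Section Scalars.

Lemma scalM a b : scal (a * b) = scal a * scal b.
Proof. by rewrite /scal polyCM rmorphM. Qed.

Lemma scal_sum (I : finType) (F : I -> algC) : scal (\sum_i F i) = \sum_i scal (F i).
Proof. by rewrite /scal raddf_sum raddf_sum. Qed.

Lemma scal_nat n : scal n%:R = n%:R.
Proof. by rewrite /scal polyC_natr rmorph_nat. Qed.

Lemma scal0 : scal 0 = 0. Proof. by rewrite /scal polyC0 rmorph0. Qed.

Lemma natr_Kz_eq0 n : (n%:R == 0 :> Kz) = (n == 0%N).
Proof. by rewrite -scal_nat /scal tofrac_eq0 polyC_eq0 pnatr_eq0. Qed.

Lemma scalV_nat n : scal n%:R^-1 = n%:R^-1.
Proof.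
case: n => [|n]; first by rewrite invr0 scal0 invr0.
have h : (n.+1%:R : Kz) != 0 by rewrite natr_Kz_eq0.
by apply: (mulfI h); rewrite -{1}scal_nat -scalM !mulfV // pnatr_eq0.
Qed.

Lemma zvar_neq0 : zvar != 0.
Proof. by rewrite /zvar tofrac_eq0 polyX_eq0. Qed.

End Scalars.

Lemma scale_mulr_linear (R : comNzRingType) (A : algType R) (a c : R) (x y y' : A) :
  a *: (x * (c *: y + y')) = c *: (a *: (x * y)) + a *: (x * y').
Proof. by rewrite mulrDr scalerDr -scalerAr !scalerA mulrC. Qed.

Lemma scale_mulr_bool (R : comNzRingType) (A : comAlgType R) (a : R) (b : bool) (x y : A) :
  a *: (x * (b%:R *: y)) = if b then a *: (y * x) else 0.
Proof. by case: b; [rewrite scale1r mulrC | rewrite scale0r mulr0 scaler0]. Qed.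

(** * Iterated derivatives of monomials *)

Section Deriv.
Variables (N : nat) (v : nat -> 'I_N) (R : comNzRingType).
Implicit Types (s l : seq nat).

Lemma mderiv_prod_eq0 i (I : Type) (r : seq I) (F : I -> {mpoly R[N]}) :
  (forall j, mderiv i (F j) = 0) -> mderiv i (\prod_(j <- r) F j) = 0.
Proof.
move=> F0; apply: (big_ind (fun p => mderiv i p = 0)) => //.
  by rewrite -mpolyC1 mderivC.
by move=> p q hp hq; rewrite mderivM hp hq mulr0 mul0r addr0.
Qed.

Lemma mderiv_var i j : mderiv i ('X_j : {mpoly R[N]}) = (j == i)%:R.
Proof.
rewrite mderivX mnm1E; case: eqP => [->|_]; last by rewrite scale0r.
by rewrite -{1}[U_(i)%MM]add0m addmK mpolyX0 scale1r.
Qed.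

Lemma mderiv_varprod_notin (I : Type) (w : I -> 'I_N) i (r : seq I) :
  (forall q, w q != i) -> mderiv i (\prod_(q <- r) 'X_(w q) : {mpoly R[N]}) = 0.
Proof. by move=> wi; apply: mderiv_prod_eq0 => q; rewrite mderiv_var (negPf (wi q)). Qed.

Definition varprod l : {mpoly R[N]} := \prod_(r <- l) 'X_(v r).

(** Injectivity is asked only on [D] because [tvar] goes through [inord], which separates only the
    indices up to [d]. *)
Lemma mderiv_varprod (D : pred nat) r l :
  {in D &, injective v} -> r \in D -> {subset l <= D} ->
  mderiv (v r) (varprod l) = (count_mem r l)%:R *: varprod (rem r l).
Proof.
move=> vinj rD; elim: l => [|q l IH] lD.
  by rewrite /varprod big_nil scale0r -mpolyC1 mderivC.
have qD : q \in D by apply: lD; rewrite mem_head.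
have {}IH : _ = _ := IH (fun x h => lD x (@mem_behead _ (q :: l) x h)).
have -> : varprod (q :: l) = 'X_(v q) * varprod l by rewrite /varprod big_cons.
rewrite mderivM mderiv_var IH /=.
have -> : (v q == v r) = (q == r) by apply/eqP/eqP => [/vinj->|->].
case: eqP => [->|_]; last by rewrite mul0r add0r add0n -scalerAr /varprod big_cons.
rewrite mul1r add1n -natr1 scalerDl scale1r addrC; congr (_ + _).
have [rl|rl] := boolP (r \in l); last by rewrite (count_memPn rl) !scale0r mulr0.
rewrite -scalerAr; congr (_ *: _).
by rewrite /varprod (perm_big _ (perm_to_rem rl)) big_cons.
Qed.

(** Each derivative removes one part from [l], or gives zero if that part is absent. As the sums
    agree and parts are positive, nothing of [l] remains when [s] is exhausted. The factor [P]
    stands for the other families of variables. *)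
Lemma foldr_mderiv_varprod b (P : {mpoly R[N]}) s l :
  let D := [pred r | 0 < r < b]%N in
  {in D &, injective v} -> {in D, forall r, mderiv (v r) P = 0} ->
  {subset s <= D} -> {subset l <= D} -> sumn s = sumn l ->
  foldr (fun r => mderiv (v r)) (P * varprod l) s =
    (if perm_eq s l then (\prod_(1 <= r < b) (count_mem r l)`!)%N%:R else 0) *: P.
Proof.
(* [foldr] applies the derivative of the last part first, hence the induction from the right. *)
move=> D vinj P0; elim/last_ind: s l => [|s r IH] l sD lD e.
  case: l e lD => [|q l] /= e lD.
    by rewrite /varprod big_nil mulr1 big1 ?scale1r.
  have := lD q (mem_head _ _); rewrite inE => /andP[q0 _].
  by case: q q0 e {lD}.
have rD : r \in D by apply: sD; rewrite mem_rcons mem_head.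
have {}sD : {subset s <= D} by move=> x xs; apply: sD; rewrite mem_rcons inE xs orbT.
rewrite foldr_rcons mderivM P0 // mul0r add0r (mderiv_varprod vinj) // -scalerAr.
have Z c (F : {mpoly R[N]}) s' :
    foldr (fun r => mderiv (v r)) (c *: F) s' = c *: foldr (fun r => mderiv (v r)) F s'.
  by elim: s' => //= q s' ->; rewrite mderivZ.
rewrite Z; have [rl|rl] := boolP (r \in l); last first.
  rewrite (count_memPn rl) scale0r ifN ?scale0r //.
  by apply: contra rl => /perm_mem <-; rewrite mem_rcons mem_head.
have pl := perm_to_rem rl.
rewrite IH //; first last.
- by move: e; rewrite sumn_rcons (perm_sumn pl) /= addnC => /addnI.
- by move=> x /mem_rem; exact: lD.
have -> : perm_eq (rcons s r) l = perm_eq s (rem r l).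
  by rewrite (permPr pl) perm_rcons perm_cons.
case: ifP => _; last by rewrite !scale0r scaler0.
rewrite scalerA -natrM; congr (_%:R *: _).
have rb : r \in index_iota 1 b by move: rD; rewrite mem_index_iota inE.
rewrite !(bigD1_seq r rb (iota_uniq _ _)) /= mulnA.
have c0 : (0 < count_mem r l)%N by rewrite -has_count has_pred1.
(* The multiplicity of [r] comes from the derivative, and the factorial of its predecessor from the
   remaining list. *)
congr (_ * _)%N.
  by rewrite count_mem_rem eqxx subn1 -[in RHS](prednK c0) factS prednK.
by apply: eq_bigr => q qr; rewrite count_mem_rem eq_sym (negPf qr) subn0.
Qed.

End Deriv.

(** * Action of the cut-and-join operator on generating functions *)

Section Operator.
Variables (k d : nat).
Implicit Types (D G H : intpartn d) (F : timepoly k d).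

Lemma tvar_inj (f f' : 'I_k.+1) r r' :
  tvar d f r = tvar d f' r' -> f = f' /\ inord r = inord r' :> 'I_d.+1.
Proof. by move/cast_ord_inj/enum_rank_inj => [-> ->]. Qed.

Lemma part_bounds D r : r \in parts D -> (0 < r < d.+1)%N.
Proof.
have /and3P[_ D0 /eqP sD] := intpartnP D => rD.
have := part_leq rD; rewrite sD ltnS => ->; rewrite lt0n andbT.
by apply: contraNneq D0 => <-.
Qed.

Lemma dpart_linear D : linear (@dpart k d D).
Proof.
move=> c F F'; rewrite /dpart scalerA mulrC -scalerA -scalerDr; congr (_ *: _).
by elim: (parts D) => //= r s ->; rewrite linearP.
Qed.

Lemma cutjoin_linear D : linear (@cutjoin k d D).
Proof.
move=> c F F'; rewrite /cutjoin scaler_sumr -big_split; apply: eq_bigr => G _.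
rewrite scaler_sumr -big_split; apply: eq_bigr => G' _ /=.
have -> : dpart G' (c *: F + F') = c *: dpart G' F + dpart G' F' by exact: dpart_linear.
exact: (@scale_mulr_linear Kz (timepoly k d)).
Qed.

HB.instance Definition _ D :=
  GRing.isLinear.Build Kz (timepoly k d) (timepoly k d) *:%R
    (@cutjoin k d D) (@cutjoin_linear D).

Definition family_monomial (Gs : k.-tuple (intpartn d)) : timepoly k d :=
  \prod_(i < k) pmon (lift ord0 i) (tnth Gs i).

Lemma mderiv_family_monomial (Gs : k.-tuple (intpartn d)) r :
  mderiv (tvar d (ord0 : 'I_k.+1) r) (family_monomial Gs) = 0.
Proof.
apply: mderiv_prod_eq0 => i; apply: mderiv_varprod_notin => q.
by apply/eqP => /tvar_inj[].
Qed.

(** The multiplicity factorials created by the derivatives are those divided out in [dpart];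
    partitions being sorted, equality up to permutation is equality. *)
Lemma dpart_monomial G G' (Gs : k.-tuple (intpartn d)) :
  dpart G' (family_monomial Gs * pmon ord0 G) = (G' == G)%:R *: family_monomial Gs.
Proof.
rewrite /dpart (foldr_mderiv_varprod (b := d.+1)); first last.
- by have /and3P[_ _ /eqP->] := intpartnP G; have /and3P[_ _ /eqP->] := intpartnP G'.
- by move=> r; exact: part_bounds.
- by move=> r; exact: part_bounds.
- by move=> r _; exact: mderiv_family_monomial.
- move=> r r'; rewrite !inE => /andP[_ rd] /andP[_ rd'] /tvar_inj[_].
  by move/(congr1 val); rewrite /= !inordK.
have -> : perm_eq G' G = (G' == G).
  apply/idP/eqP => [h|-> //]; apply: val_inj.
  have /and3P[sG _ _] := intpartnP G; have /and3P[sG' _ _] := intpartnP G'.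
  apply: sorted_eq sG' sG h.
    by move=> m n q h1 h2; exact: leq_trans h2 h1.
  by move=> m n /anti_leq.
case: eqP => [->|_]; last by rewrite !scale0r scaler0.
rewrite scalerA mulVf // natr_Kz_eq0 -lt0n /part_fact prodn_gt0 // => i.
exact: fact_gt0.
Qed.

Lemma cutjoin_monomial D G (Gs : k.-tuple (intpartn d)) :
  cutjoin D (family_monomial Gs * pmon ord0 G) =
    \sum_H (scal ((d`!)%:R / #|cycle_class G|%:R * mu 0 [:: G; D; H])
      * zvar ^ (d%:Z + (size G)%:Z - (size D)%:Z - (size H)%:Z))
      *: (family_monomial Gs * pmon ord0 H).
Proof.
apply: eq_bigr => H _; rewrite (bigD1 G) //= big1 => [|G' /negPf nG].
  by rewrite addr0 dpart_monomial (@scale_mulr_bool Kz (timepoly k d)) eqxx.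
by rewrite dpart_monomial (@scale_mulr_bool Kz (timepoly k d)) nG.
Qed.

(** The coefficient of [Phi] without its factorials, for an arbitrary list of ramification types; in
    this form [cutjoin] simply prepends an entry. *)
Definition Phi_list g (L : seq (intpartn d)) : timepoly k d :=
  \sum_(G : intpartn d) \sum_(Gs : k.-tuple (intpartn d))
    (zvar ^ euler g (L ++ Gs ++ [:: G]) * scal (mu g (L ++ Gs ++ [:: G])))
      *: (family_monomial Gs * pmon ord0 G).

(** The power of [z] in [cutjoin] is exactly the change of [2h - 2] when [G] is replaced by the two
    types [D] and [H]. *)
Lemma euler_glue g (L : seq (intpartn d)) D G H :
  euler g (rcons L G) + (d%:Z + (size G)%:Z - (size D)%:Z - (size H)%:Z) =
  euler g (D :: rcons L H).
Proof. rewrite /euler big_cons !big_rcons /=; ring. Qed.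

Lemma cutjoin_Phi_list g (L : seq (intpartn d)) D :
  cutjoin D (Phi_list g L) = Phi_list g (D :: L).
Proof.
rewrite /Phi_list linear_sum /=.
under eq_bigr => G _ do rewrite linear_sum /=; rewrite exchange_big /=.
rewrite [RHS]exchange_big /=; apply: eq_bigr => Gs _.
under eq_bigr => G _ do rewrite linearZ /= cutjoin_monomial scaler_sumr.
rewrite exchange_big /=; apply: eq_bigr => H _.
under eq_bigr => G _ do rewrite scalerA; rewrite -scaler_suml; congr (_ *: _).
(* For fixed [Gs] and [H], the sum over [G] is the gluing sum with [L ++ Gs] as the remaining
   types. *)
rewrite !catA !cats1 -mu_glue scal_sum mulr_sumr; apply: eq_bigr => G _.
rewrite !catA !cats1 -(euler_glue _ _ _ G).
rewrite [zvar ^ (euler _ _ + _)]expfzDr ?zvar_neq0 // !scalM.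
set a := zvar ^ _; set b := zvar ^ _; ring.
Qed.

Lemma iter_cutjoin_Phi_list g (L : seq (intpartn d)) D l :
  iter l (cutjoin D) (Phi_list g L) = Phi_list g (nseq l D ++ L).
Proof. by elim: l => //= l ->; rewrite cutjoin_Phi_list. Qed.

End Operator.

(** * Exponentials of operators raising one exponent *)

Section OpExp.
Variables (n : nat) (A : lmodType Kz).
Implicit Types (W : {linear A -> A}) (F : fps n A) (j : 'I_n) (m : 'X_{1..n}).

Lemma iter_umul j W F m l :
  iter l (umul j W) F m =
    if (l <= m j)%N then iter l W (F (m - U_(j) *+ l)%MM) else 0.
Proof.
elim: l m => [|l IH] m; first by rewrite mulm0n subm0.
rewrite /= {1}/umul IH mnmBE mnm1E eqxx mulmS submDA.
case: eqP => [->//|/eqP mj]; rewrite -ltnS subn1 prednK ?lt0n //.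
by case: ifP => _ //; rewrite raddf0.
Qed.

Lemma iter_linear0 W l : iter l W 0 = 0.
Proof. by elim: l => //= l ->; rewrite linear0. Qed.

Lemma iter_linearZ W l c x : iter l W (c *: x) = c *: iter l W x.
Proof. by elim: l => //= l ->; rewrite linearZ. Qed.

Lemma op_exp_umul j W F m :
  (forall m, m j != 0%N -> F m = 0) ->
  op_exp (umul j W) F m =
    ((m j)`!%:R : Kz)^-1 *: iter (m j) W (F (m - U_(j) *+ m j)%MM).
Proof.
move=> F0; have mj : (m j < (mdeg m).+1)%N.
  by rewrite ltnS mdegE (bigD1 j) //= leq_addr.
rewrite /op_exp (bigD1 (Ordinal mj)) //= big1 ?addr0 => [|l lj].
  by rewrite iter_umul leqnn.
rewrite iter_umul; case: ifP => lm; last by rewrite scaler0.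
(* For [l] below [m j] the remaining exponent of [u_j] is positive, where [F] vanishes. *)
rewrite F0 ?iter_linear0 ?scaler0 // mnmBE mulmnE mnm1E eqxx mul1n.
rewrite subn_eq0 -ltnNge ltn_neqAle lm andbT.
by apply: contraNneq lj => e; apply/eqP/val_inj.
Qed.

End OpExp.

(** * The product of exponentials *)

Section ExpCutjoin.
Variables (g k d n : nat) (Delta : n.-tuple (intpartn d)).

(** Induction on the factors: those to the right of [j] never produce [u_j], since [r] has no
    repetition. The leftmost factor acts last and prepends its copies, so the list comes out in the
    order of [r] and no commutation of operators is needed. *)
Lemma big_op_exp (r : seq 'I_n) (m : 'X_{1..n}) : uniq r ->
  (\big[(fun S T => S \o T)/id]_(j <- r)
     op_exp (umul j (@cutjoin k d (tnth Delta j))))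
    (fps_const n (Phi_list k g [::])) m =
  if [forall j, (m j != 0%N) ==> (j \in r)] then
    (\prod_(j <- r) ((m j)`!%:R : Kz)^-1) *:
      Phi_list k g (flatten [seq nseq (m j) (tnth Delta j) | j <- r])
  else 0.
Proof.
elim: r m => [|j r IH] m.
  move=> _; rewrite !big_nil /= scale1r /fps_const; congr (if _ then _ else _).
  apply/eqP/forallP => [-> i|h]; first by rewrite mnm0E eqxx.
  by apply/mnmP => i; have := h i; rewrite mnm0E implybF negbK => /eqP.
move=> /= /andP[jr ur]; rewrite big_cons /=.
rewrite (@op_exp_umul n _ j (@cutjoin k d (tnth Delta j))) => [|m' m'j]; last first.
  rewrite IH // ifN //; apply/forallPn; exists j.
  by rewrite m'j.
rewrite IH //; set m0 := (m - _)%MM.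
(* [m0] is [m] with the exponent of [u_j] set to zero. *)
have m0E i : m0 i = if i == j then 0%N else m i.
  rewrite mnmBE mulmnE mnm1E eq_sym; case: eqP => [->|_]; first by rewrite mul1n subnn.
  by rewrite mul0n subn0.
have m0r i : i \in r -> m0 i = m i.
  by move=> ir; rewrite m0E; case: eqP ir jr => // -> ->.
have -> : [forall i, (m0 i != 0%N) ==> (i \in r)] =
          [forall i, (m i != 0%N) ==> (i \in j :: r)].
  apply: eq_forallb => i; rewrite m0E inE.
  by case: (i == j) => //=; rewrite implybT.
case: ifP => _; last by rewrite iter_linear0 scaler0.
rewrite iter_linearZ scalerA iter_cutjoin_Phi_list big_cons.
congr (_ * _ *: Phi_list k g (_ ++ _)).
  by apply: eq_big_seq => i ir; rewrite m0r.
by congr flatten; apply/eq_in_map => i ir; rewrite m0r.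
Qed.

Lemma PhiE (m : 'X_{1..n}) : Phi g k Delta m =
  (\prod_(j < n) ((m j)`!%:R : Kz)^-1) *: Phi_list k g (repeated Delta m).
Proof.
rewrite /Phi /Phi_list scaler_sumr; apply: eq_bigr => G _.
rewrite scaler_sumr; apply: eq_bigr => Gs _.
by rewrite scalerA mulrC.
Qed.

Lemma exp_cutjoin_Phi_list :
  exp_cutjoin Delta (fps_const n (Phi_list k g [::])) =1 Phi g k Delta.
Proof.
move=> m; rewrite PhiE /exp_cutjoin big_op_exp ?index_enum_uniq //.
case: ifP => [_|/negP[]]; last by apply/forallP => j; rewrite mem_index_enum implybT.
by rewrite /repeated enumT.
Qed.

End ExpCutjoin.

(** * Initial conditions on the sphere *)

Lemma Phi_nouE g d k : Phi_nou g d k = Phi_list k g [::].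
Proof.
rewrite /Phi_nou PhiE big_ord0 scale1r /repeated.
by rewrite (size0nil (size_enum_ord 0)).
Qed.

Lemma sum_tuple0 (V : nmodType) (T : finType) (F : 0.-tuple T -> V) :
  \sum_t F t = F [tuple].
Proof. by apply: big_pred1 => t; apply/esym/eqP/tuple0. Qed.

Lemma sum_tuple1 (V : nmodType) (T : finType) (F : 1.-tuple T -> V) :
  \sum_t F t = \sum_x F [tuple x].
Proof.
apply: reindex; exists (@thead 0 T) => [x _ | t _]; first by rewrite theadE.
by case/tupleP: t => x t; rewrite theadE; apply: val_inj; rewrite /= (tuple0 t).
Qed.

Section SmallCases.
Variables (g d : nat).
Implicit Types (D G H : intpartn d) (L : seq (intpartn d)).

Lemma Phi_list_single L :
  Phi_list 0 g L =
    \sum_G (zvar ^ euler g (rcons L G) * scal (mu g (rcons L G))) *: pmon ord0 G.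
Proof.
apply: eq_bigr => G _; rewrite sum_tuple0 /= cats1.
by rewrite /family_monomial big_ord0 mul1r.
Qed.

Lemma Phi_list_double L :
  Phi_list 1 g L = \sum_G \sum_H
    (zvar ^ euler g (L ++ [:: G; H]) * scal (mu g (L ++ [:: G; H])))
     *: (pmon (lift ord0 ord0) G * pmon ord0 H).
Proof.
rewrite /Phi_list; under eq_bigr => H _ do rewrite sum_tuple1.
rewrite exchange_big /=; apply: eq_bigr => G _; apply: eq_bigr => H _.
by rewrite /family_monomial big_ord1.
Qed.

Lemma euler_cat L L' :
  euler g (L ++ L') = \sum_(D <- L) (d%:Z - (size D)%:Z) + euler g L'.
Proof. by rewrite /euler big_cat /= addrA. Qed.

End SmallCases.

(** With one branch point on the sphere the covering is [d] disjoint unramified spheres: [2h - 2] is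
    [-2d] and the automorphisms number [d!]. *)
Lemma init_singleE d : init_single d = Phi_list 0 0 [::].
Proof.
rewrite Phi_list_single (bigD1 (one_part d)) //=.
rewrite [X in _ + X]big1 => [|G /negPf nG]; last first.
  by rewrite mu0_single nG mulr0n scal0 mulr0 scale0r.
rewrite addr0 mu0_single eqxx mulr1n scalV_nat /init_single.
congr (zvar ^ _ * _ *: _).
  by rewrite /euler big_seq1 parts_one_part size_nseq; ring.
by rewrite /pmon parts_one_part big_nseq iter_mulr_1.
Qed.

(** With two branch points both types equal [D] and the covering is one sphere per part, whence the
    exponent [-2 l(D)]. *)
Lemma init_doubleE d : init_double d = Phi_list 1 0 [::].
Proof.
rewrite Phi_list_double; apply: eq_bigr => D _.
rewrite (bigD1 D) //= [X in _ + X]big1 => [|G nG]; last first.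
  by rewrite mu0_pair eq_sym (negPf nG) mulr0n scal0 mulr0 scale0r.
rewrite addr0 mu0_pair eqxx mulr1n scalM scal_nat scalV_nat.
congr (zvar ^ _ * _ *: _).
by rewrite /euler big_cons big_seq1; ring.
Qed.

(** * Simple branch points and classical Hurwitz numbers *)

Section SimpleBranching.
Variables (d : nat) (hd : (1 < d)%N).
Let D := simple_part hd.

Lemma repeated1 (m : 'X_{1..1}) : repeated [tuple D] m = nseq (m ord0) D.
Proof. by rewrite /repeated enum_ordSl (size0nil (size_enum_ord 0)) /= cats0. Qed.

Lemma sum_simple_part l : \sum_(E <- nseq l D) (d%:Z - (size E)%:Z) = l%:Z.
Proof.
rewrite big_nseq /= size_nseq.
(* The partition with one part 2 and [d - 2] ones has [d - 1] parts. *)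
have -> : d%:Z - d.-2.+1%:Z = 1.
  by case: (d) hd => [|[|b]] //= _; rewrite subzn // subSnn.
by elim: l => //= l ->; rewrite intS.
Qed.

Lemma Phi_hurwitz_single : Phi 0 0 [tuple D] =1 hurwitz_single_gen hd.
Proof.
move=> m; rewrite PhiE repeated1 big_ord1 Phi_list_single scaler_sumr.
apply: eq_bigr => G _; rewrite scalerA mulrC -cats1; congr (zvar ^ _ * _ / _ *: _).
by rewrite euler_cat sum_simple_part /euler big_seq1; ring.
Qed.

Lemma Phi_hurwitz_double : Phi 0 1 [tuple D] =1 hurwitz_double_gen hd.
Proof.
move=> m; rewrite PhiE repeated1 big_ord1 Phi_list_double scaler_sumr.
apply: eq_bigr => G _; rewrite scaler_sumr; apply: eq_bigr => H _.
rewrite scalerA mulrC; congr (zvar ^ _ * _ / _ *: _).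
by rewrite euler_cat sum_simple_part /euler big_cons big_seq1; ring.
Qed.

End SimpleBranching.

Lemma exp_cutjoin1 k d (D : intpartn d) :
  exp_cutjoin [tuple D] = op_exp (umul ord0 (@cutjoin k d D)).
Proof. by rewrite /exp_cutjoin big_ord_recl big_ord0. Qed.

Theorem corollary4p4 (g d k n : nat) (hd : (0 < d)%N) (hn : (0 < n)%N)
    (Delta : n.-tuple (intpartn d)) :
  [/\ Phi g k Delta
        =1 exp_cutjoin Delta (fps_const n (Phi_nou g d k)),
      Phi 0 0 Delta
        =1 exp_cutjoin Delta (fps_const n (init_single d)),
      Phi 0 1 Delta
        =1 exp_cutjoin Delta (fps_const n (init_double d)) &
      forall hd2 : (1 < d)%N,
        let D := simple_part hd2 in
        [/\ Phi 0 0 [tuple D]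
              =1 op_exp (umul ord0 (cutjoin D)) (fps_const 1 (init_single d)),
            Phi 0 1 [tuple D]
              =1 op_exp (umul ord0 (cutjoin D)) (fps_const 1 (init_double d)),
            Phi 0 0 [tuple D] =1 hurwitz_single_gen hd2 &
            Phi 0 1 [tuple D] =1 hurwitz_double_gen hd2]].
Proof.
rewrite Phi_nouE init_singleE init_doubleE.
split; try by move=> m; rewrite exp_cutjoin_Phi_list.
move=> hd2 D; rewrite -!exp_cutjoin1; split.
- by move=> m; rewrite exp_cutjoin_Phi_list.
- by move=> m; rewrite exp_cutjoin_Phi_list.
- exact: Phi_hurwitz_single.
- exact: Phi_hurwitz_double.
Qed.
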